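(* Let $n,k$ be positive integers. Define positive integers $\mu_1,\mu_2,\ldots$ recursively by $\mu_1=\lceil n/k\rceil$ and, for $i\ge 2$, $$\mu_i=\left\lceil \Bigl(n-\sum_{j<i}\mu_j\Bigr)\Big/k\right\rceil,$$ stopping as soon as $\sum_{j\le i}\mu_j=n$, and let $\mu=(\mu_1,\ldots,\mu_{|\mu|})$ be the resulting partition of $n$. Then $\mu$ is a partition of minimum size that generates all $k$-partitions of $n$. That is, $\mu$ generates all $k$-partitions of $n$, and every partition $\lambda$ of $n$ that generates all $k$-partitions of $n$ satisfies $|\lambda|\ge|\mu|$.
   Context: A partition $\lambda\vdash n$ is a finite sequence $\lambda=(\lambda_1\ge\lambda_2\ge\cdots\ge\lambda_l)$ of positive integers with sum $n$. Its size is the number of parts, $|\lambda|=l$. A partition $\mu$ of $n$ generates a partition $\lambda$ of $n$ if the index set $\{1,\ldots,|\mu|\}$ can be decomposed into pairwise disjoint sets $S_1,\ldots,S_{|\lambda|}$ whose union is $\{1,\ldots,|\mu|\}$ and such that $\sum_{j\in S_i}\mu_j=\lambda_i$ for every $i\in\{1,\ldots,|\lambda|\}$. A partition $\mu$ of $n$ generates all $k$-partitions of $n$ if $\mu$ generates $\lambda$ for every $\lambda\vdash n$ with $|\lambda|\le k$. *)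

(* Defs.v *)
From mathcomp Require Import all_boot all_order all_algebra.
From mathcomp Require Import zify lra.

Set Implicit Arguments.
Unset Strict Implicit.
Unset Printing Implicit Defensive.

Definition is_partition (n : nat) (s : seq nat) : bool :=
  [&& sorted geq s, 0 \notin s & sumn s == n].

(* Parts are indexed from 0, and the size of a partition is [size]. *)
Definition generates (mu lam : seq nat) : Prop :=
  exists S : 'I_(size lam) -> {set 'I_(size mu)},
    [/\ forall i i', i != i' -> [disjoint S i & S i'],
        \bigcup_(i < size lam) S i = [set: 'I_(size mu)]
      & forall i, \sum_(j in S i) nth 0 mu j = nth 0 lam i].

Definition generates_all (n k : nat) (mu : seq nat) : Prop :=
  forall lam, is_partition n lam -> size lam <= k -> generates mu lam.

Definition ceil_div (m d : nat) : nat := (m + d.-1) %/ d.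

Lemma ceil_divE (m d : nat) : 0 < d ->
  Posz (ceil_div m d) = Num.ceil (m%:R / d%:R : rat)%R.
Proof.
move=> d0; apply/esym/Num.Theory.ceil_def.
have dR : (0 < d%:R :> rat)%R by rewrite Num.Theory.ltr0n.
rewrite Num.Theory.ltr_pdivlMr // Num.Theory.ler_pdivrMr // intrB /=.
have h1 : m <= ceil_div m d * d by rewrite /ceil_div; nia.
have h2 : ceil_div m d * d < m + d by rewrite /ceil_div; nia.
move: h1 h2; rewrite -(Num.Theory.ler_nat rat) -(Num.Theory.ltr_nat rat).
rewrite GRing.natrD GRing.natrM -!pmulrn => h1 h2.
by apply/andP; split; lra.
Qed.

(* [r] is what remains to be distributed. For [0 < d] every term is positive as
   long as [r] is, so [fuel >= r] steps suffice to exhaust [r]. *)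
Fixpoint greedy_rec (fuel k r : nat) : seq nat :=
  if fuel is fuel'.+1 then
    if r == 0 then [::]
    else ceil_div r k :: greedy_rec fuel' k (r - ceil_div r k)
  else [::].

Definition greedy (n k : nat) : seq nat := greedy_rec n k n.

Lemma ceil_div_gt0 r k : 0 < k -> 0 < r -> 0 < ceil_div r k.
Proof. by move=> k0 r0; rewrite divn_gt0 //; lia. Qed.

Lemma ceil_div_le r k : 0 < k -> ceil_div r k <= r.
Proof. by rewrite /ceil_div; nia. Qed.

Lemma sumn_greedy n k : 0 < k -> sumn (greedy n k) = n.
Proof.
move=> k0; suff H f r : r <= f -> sumn (greedy_rec f k r) = r by exact: H.
elim: f r => [|f IH] r /=; first by case: r.
case: eqP => [->//|/eqP r0] rf /=.
have := ceil_div_gt0 k0 (_ : 0 < r); have := ceil_div_le r k0.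
by move=> h1 h2; rewrite IH; lia.
Qed.

Lemma nth_greedy n k i : i < size (greedy n k) ->
  nth 0 (greedy n k) i = ceil_div (n - \sum_(j < i) nth 0 (greedy n k) j) k.
Proof.
suff H f r : i < size (greedy_rec f k r) -> nth 0 (greedy_rec f k r) i =
    ceil_div (r - \sum_(j < i) nth 0 (greedy_rec f k r) j) k by exact: H.
elim: f r i => [|f IH] r i //=.
case: eqP => // _; case: i => [|i] /=; first by rewrite big_ord0 subn0.
by rewrite ltnS => /IH ->; rewrite big_ord_recl /= subnDA.
Qed.

Lemma greedy_stop n k i : 0 < k -> i < size (greedy n k) ->
  \sum_(j < i) nth 0 (greedy n k) j < n.
Proof.
move=> k0; suff H f r : i < size (greedy_rec f k r) ->
    \sum_(j < i) nth 0 (greedy_rec f k r) j < r by exact: H.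
elim: f r i => [|f IH] r i //=.
case: eqP => // /eqP r0; case: i => [|i] /=.
  by rewrite big_ord0; lia.
by rewrite ltnS => /IH; rewrite big_ord_recl /= ltn_subRL.
Qed.

(* Main.v *)
Require Import Defs.
From mathcomp Require Import all_boot.
From mathcomp Require Import zify.

Set Implicit Arguments.
Unset Strict Implicit.
Unset Printing Implicit Defensive.

(** Sufficiency is a bin-packing argument. If at most [k] bins have capacities
    adding up to [r], the largest one has capacity at least [r / k], hence at
    least [ceil_div r k], so the first greedy part fits there; what is left is
    the same situation with [r - ceil_div r k] in place of [r]
    ([greedy_rec_fills]).

    For minimality, let [lam] generate all [k]-partitions. Each of its parts
    [v] is at most the ceiling of [s / k], where [s] is the sum of [v] and of
    the parts after it ([part_le_ceil_div_tail]). Otherwise [s <= k * (v - 1)],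
    so [s] can be written with at most [k] positive terms, none above [v - 1].
    Add the sum [p] of the parts before [v] to the first of these terms, [x].
    In the resulting partition of [n], the parts up to and including [v] are
    too large for any block but the first, and the first block, equal to
    [p + x], cannot hold them, since their sum is [p + v].

    So [lam] never removes more than the greedy step would from the same
    remainder, and [r - ceil_div r k] is nondecreasing in [r]: the remainders
    of [lam] stay above the greedy ones and reach 0 no earlier
    ([size_greedy_rec_le]). *)

Lemma ceil_div_leE c r k : 0 < k -> (ceil_div r k <= c) = (r <= k * c).
Proof.
by move=> k0; rewrite /ceil_div -ltnS ltn_divLR // mulSn mulnC; lia.
Qed.

Lemma leq_ceil_div r s k : r <= s -> ceil_div r k <= ceil_div s k.
Proof. by move=> rs; rewrite /ceil_div leq_div2r // leq_add2r. Qed.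

Lemma leq_sub_ceil_div r s k : 0 < k -> r <= s ->
  r - ceil_div r k <= s - ceil_div s k.
Proof.
move=> k0 rs.
have : ceil_div s k <= ceil_div r k + (s - r).
  have : r <= k * ceil_div r k by rewrite -ceil_div_leE.
  by rewrite ceil_div_leE //; nia.
have := ceil_div_le s k0; lia.
Qed.

Lemma geq_transitive : transitive geq.
Proof. by move=> a b c /= ab ca; exact: leq_trans ca ab. Qed.

Lemma notin0_greedy_rec k f r : 0 < k -> 0 \notin greedy_rec f k r.
Proof.
move=> k0; elim: f r => [|f IH] r //=; case: eqP => // /eqP r0.
by rewrite in_cons negb_or IH andbT; have := @ceil_div_gt0 r k k0; lia.
Qed.

Lemma greedy_rec_path k f r m : ceil_div r k <= m ->
  path geq m (greedy_rec f k r).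
Proof.
elim: f r m => [|f IH] r m rm //=; case: eqP => // _ /=.
by rewrite rm; apply/IH/leq_ceil_div/leq_subr.
Qed.

Lemma greedy_is_partition n k : 0 < k -> is_partition n (greedy n k).
Proof.
move=> k0; apply/and3P; split; last by rewrite sumn_greedy.
  exact/path_sorted/greedy_rec_path/leqnn.
exact: notin0_greedy_rec.
Qed.

Lemma leq_sum_ord l (c : 'I_l -> nat) (i : 'I_l) : c i <= \sum_j c j.
Proof. by rewrite (bigD1 i) //= leq_addr. Qed.

(** Capacities may vanish and the number of bins stays the same along the
    induction: a bin filled up is kept with capacity 0. *)
Lemma greedy_rec_fills l k f r (c : 'I_l.+1 -> nat) : l < k -> r <= f ->
  \sum_i c i = r ->
  exists a : nat -> 'I_l.+1, forall i,
    \sum_(j < size (greedy_rec f k r) | a j == i)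
      nth 0 (greedy_rec f k r) j = c i.
Proof.
move=> lk; have k0 : 0 < k by exact: leq_trans lk.
elim: f r c => [|f IH] r c rf cr /=; last case: eqP => [r0|/eqP r0].
- exists (fun=> ord0) => i; rewrite big_ord0.
  by have := @leq_sum_ord _ c i; lia.
- exists (fun=> ord0) => i; rewrite big_ord0.
  by have := @leq_sum_ord _ c i; lia.
set m := ceil_div r k.
(* The largest capacity is at least the average, so at least [r / k]. *)
case: (@arg_maxnP _ ord0 xpredT c isT) => i0 _ maxc.
have mc : m <= c i0.
  rewrite ceil_div_leE // -cr.
  apply: (@leq_trans (\sum_(i < l.+1) c i0)).
    by apply: leq_sum => i _; exact: maxc.
  by rewrite sum_nat_const card_ord leq_mul2r lk orbT.
pose c' i := if i == i0 then c i0 - m else c i.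
have cr' : \sum_i c' i = r - m.
  rewrite -cr (bigD1 i0) //= [in RHS](bigD1 i0) //= /c' eqxx addnBAC //.
  by congr (_ + _ - _); apply: eq_bigr => i /negbTE ->.
have rm : r - m <= f by have := @ceil_div_gt0 r k k0; rewrite -/m; lia.
have [a Ha] := IH _ _ rm cr'.
exists (fun j => if j is j'.+1 then a j' else i0) => i.
rewrite big_mkcond big_ord_recl /= -big_mkcond /= Ha /c' [i == i0]eq_sym.
by case: eqP => // <-; rewrite subnKC.
Qed.

Lemma greedy_generates_all n k : 0 < n -> generates_all n k (greedy n k).
Proof.
move=> n0 [|x lam] /and3P[_ _ /eqP] sn; first by rewrite -sn in n0.
move=> lk; rewrite /generates.
have cr : \sum_(i < (size lam).+1) nth 0 (x :: lam) i = n.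
  by rewrite -sn sumnE (big_nth 0) big_mkord.
have [a Ha] := greedy_rec_fills lk (leqnn n) cr.
exists (fun i => [set j : 'I_(size (greedy n k)) | a j == i]); split.
- move=> i i' ii'; rewrite -setI_eq0; apply/eqP/setP => j; rewrite !inE.
  by apply: contraNF ii' => /andP[/eqP <- /eqP <-].
- by apply/setP => j; rewrite !inE; apply/bigcupP; exists (a j); rewrite ?inE.
- by move=> i; rewrite -Ha; apply: eq_bigl => j; rewrite inE.
Qed.

(** Taking terms equal to [w] as long as possible, and then the rest, gives a
    decreasing list. The order matters: such a list is still sorted, hence
    still a partition, after its first term is enlarged. *)
Lemma bounded_decomposition k w s : s <= k * w ->
  exists xs, [/\ path geq w xs, 0 \notin xs, size xs <= k & sumn xs = s].
Proof.
elim: k s => [|k IH] s sk; first by exists [::]; split=> //=; lia.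
have [->|s0] := posnP s; first by exists [::].
have [sw|ws] := leqP s w.
  by exists [:: s]; split; rewrite /= ?sw ?inE ?addn0 //; lia.
have [xs [pxs nxs sxs sumxs]] : exists xs, [/\ path geq w xs, 0 \notin xs,
    size xs <= k & sumn xs = s - w] by apply: IH; nia.
exists (w :: xs); split => //=; first by rewrite leqnn.
  by rewrite inE negb_or nxs andbT; nia.
by lia.
Qed.

(** A part violating the bound leaves a tail small enough to be cut into at
    most [k] terms below that part; attaching all the earlier parts to one of
    these terms gives a partition that [lam] cannot generate. *)
Lemma part_le_ceil_div_tail n k lam i : 0 < k ->
  is_partition n lam -> generates_all n k lam -> i < size lam ->
  nth 0 lam i <= ceil_div (sumn (drop i lam)) k.
Proof.
move=> k0 /and3P[sorted_lam lam0 /eqP sum_lam] gen ilt.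
rewrite leqNgt; apply/negP; set v := nth 0 lam i => vgt.
have sumE : n = sumn (take i lam) + sumn (drop i lam).
  by rewrite -sumn_cat cat_take_drop.
have tail_gt0 : 0 < sumn (drop i lam).
  by rewrite (drop_nth 0) //=; have := mem_nth 0 ilt; lia.
have [] := @bounded_decomposition k v.-1 (sumn (drop i lam)).
  by rewrite -ceil_div_leE //; lia.
case=> [|x xs] [/= pxs xs0 sxs sumxs]; first by rewrite -sumxs in tail_gt0.
case/andP: pxs => xv pxs.
pose target := (sumn (take i lam) + x) :: xs.
have /gen/(_ sxs)[S [_ Scover Ssum]] : is_partition n target.
  apply/and3P; split; last by rewrite /= -addnA sumxs -sumE.
    by apply: (path_le geq_transitive _ pxs); exact: leq_addl.
  by move: xs0; rewrite !inE !negb_or => /andP[x0 ->]; lia.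
(* A part that is at least [v] exceeds every block of the target but the
   first. *)
have large_in_first (j : 'I_(size lam)) : j <= i -> j \in S ord0.
  move=> ji.
  have vj : v <= nth 0 lam j.
    have := sorted_leq_nth geq_transitive leqnn 0 sorted_lam.
    by apply; rewrite // inE.
  have /bigcupP[b _ jb] : j \in \bigcup_b S b by rewrite Scover inE.
  have : nth 0 lam j <= nth 0 target b.
    by rewrite -Ssum (bigD1 j) //= leq_addr.
  case: b jb => [[|b] blt] jb /= le_b.
    by rewrite (_ : ord0 = Ordinal blt) //; exact: val_inj.
  have : nth 0 xs b <= v.-1.
    have pxs' := path_le geq_transitive xv pxs.
    apply: (allP (order_path_min geq_transitive pxs')).
    by apply: mem_nth; exact: blt.
  by lia.
have le_first : \sum_(j < size lam | j < i.+1) nth 0 lam j <= nth 0 target 0.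
  rewrite -(Ssum ord0) big_mkcond [leqRHS]big_mkcond /=; apply: leq_sum => j _.
  by case: leqP => // /large_in_first ->.
have head_sum :
    \sum_(j < size lam | j < i.+1) nth 0 lam j = sumn (take i lam) + v.
  rewrite -(big_ord_widen (size lam) (nth 0 lam) ilt) -sumn_rcons -take_nth //.
  rewrite sumnE (big_nth 0) big_mkord size_takel //.
  by apply: eq_bigr => j _; rewrite nth_take.
by move: le_first; rewrite head_sum leq_add2l; lia.
Qed.

(** The remainder of [t] is at least the greedy one at the start, and stays so
    at each step: [t] removes no more than the greedy step on its own
    remainder, and [r - ceil_div r k] is nondecreasing in [r]. *)
Lemma size_greedy_rec_le k f r t : 0 < k -> r <= sumn t ->
  (forall i, i < size t -> nth 0 t i <= ceil_div (sumn (drop i t)) k) ->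
  size (greedy_rec f k r) <= size t.
Proof.
move=> k0; elim: t f r => [|x t IH] [|f] r //=; first by rewrite leqn0 => ->.
move=> rt bound; case: eqP => // _ /=; rewrite ltnS; apply: IH => [|i it].
  have := leq_sub_ceil_div k0 rt; have := bound 0 isT; rewrite /=; lia.
exact: (bound i.+1 it).
Qed.

Theorem theorem1 (n k : nat) (hn : 0 < n) (hk : 0 < k) :
  [/\ is_partition n (greedy n k),
      generates_all n k (greedy n k)
    & forall lam : seq nat, is_partition n lam -> generates_all n k lam ->
        size (greedy n k) <= size lam].
Proof.
split; [exact: greedy_is_partition | exact: greedy_generates_all |].
move=> lam plam gen; apply: size_greedy_rec_le => //.
  by case/and3P: plam => _ _ /eqP ->.
by move=> i; exact: part_le_ceil_div_tail plam gen.
Qed.
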